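(* Let $\phi,\theta\in[0,\pi]$ and $\Psi=\sin\phi\sin\theta$. When the base station is equipped with a continuous-aperture planar array with side lengths $L_x,L_z$, its (integral-form) channel gain $\tilde{\mathsf{G}}_{\mathsf{p}}$, defined in the context, satisfies $$\lim_{L_x,L_z\rightarrow\infty}\tilde{\mathsf{G}}_{\mathsf{p}}=\frac{\eta}{8\,\mathsf{R}_{\mathsf{rad}}}\left(\frac{1}{2}-\frac{1}{24\pi^2}\frac{\lambda^2}{r^2\Psi^2}+\frac{1}{160\pi^4}\frac{\lambda^4}{r^4\Psi^4}\right).$$ When the reactive terms (those involving $f_5$ and $f_7$) are omitted from $\tilde{\mathsf{G}}_{\mathsf{p}}$, one has instead $$\lim_{L_x,L_z\rightarrow\infty}\tilde{\mathsf{G}}_{\mathsf{p}}=\frac{\eta}{8\,\mathsf{R}_{\mathsf{rad}}}\cdot\frac{1}{2}.$$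
   Context: Parameters: $r>0$ is the distance from the user to the array center, $\phi,\theta\in[0,\pi]$ are the azimuth and elevation angles, $\lambda>0$ is the wavelength, $L_x,L_z>0$ are the side lengths of the aperture, $\eta=120\pi$ is the free-space impedance, and $\mathsf{R}_{\mathsf{rad}}>0$ is the radiation resistance. All parameters other than $L_x,L_z$ are fixed in the limits. Notation: $\Phi=\cos\phi\sin\theta$, $\Psi=\sin\phi\sin\theta$, $\Theta=\cos\theta$, $k_0=\frac{2\pi}{\lambda}$. For $n\in\{3,5,7\}$ define $$f_n(x,z)=\big((x-\Phi)^2+\Psi^2+(z-\Theta)^2\big)^{-n/2}.$$ Let $\tilde{\mathcal{H}}=\{(x,z): -\frac{L_x}{2r}\le x\le\frac{L_x}{2r},\ -\frac{L_z}{2r}\le z\le\frac{L_z}{2r}\}$. The channel gain is $$\tilde{\mathsf{G}}_{\mathsf{p}}=\frac{\eta}{8\,\mathsf{R}_{\mathsf{rad}}}\,\frac{\Psi}{4\pi}\iint_{\tilde{\mathcal{H}}}\Big(f_3(x,z)-\frac{1}{k_0^2r^2}f_5(x,z)+\frac{1}{k_0^4r^4}f_7(x,z)\Big)\,dx\,dz.$$ With the reactive terms omitted, the integrand is $f_3(x,z)$ alone.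
   Formalization: The formal theorem assumes Ψ ≠ 0 (so φ, θ lie strictly between 0 and π): at Ψ = 0 the first formula divides by zero, and in the second the prefactor Ψ vanishes while the integral of f_3 diverges. *)

(* Defs.v *)
From HB Require Import structures.
From mathcomp Require Import all_boot all_order all_algebra.
From mathcomp Require Import all_classical all_reals all_analysis.

Set Implicit Arguments.
Unset Strict Implicit.
Unset Printing Implicit Defensive.

Import Order.TTheory GRing.Theory Num.Theory.
Import numFieldNormedType.Exports.

Local Open Scope classical_set_scope.
Local Open Scope ring_scope.

Definition Phi (R : realType) (phi theta : R) : R := cos phi * sin theta.
Definition Psi (R : realType) (phi theta : R) : R := sin phi * sin theta.
Definition Theta (R : realType) (theta : R) : R := cos theta.

Definition wavenumber (R : realType) (lambda : R) : R := 2 * pi / lambda.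

Definition free_space_impedance (R : realType) : R := 120 * pi.

(* When Psi phi theta != 0 the base of the power is positive everywhere, so
   the convention powR 0 y = 0 (for y != 0) plays no role. *)
Definition f_ (R : realType) (phi theta : R) (n : nat) (x z : R) : R :=
  ((x - Phi phi theta) ^+ 2 + Psi phi theta ^+ 2 + (z - Theta theta) ^+ 2)
    `^ (- (n%:R / 2)).

Definition aperture (R : realType) (r Lx Lz : R) : set (R * R) :=
  `[- (Lx / (2 * r)), Lx / (2 * r)] `*` `[- (Lz / (2 * r)), Lz / (2 * r)].

(* The double integral is a Lebesgue integral for the product measure; it
   agrees with the Riemann double integral for continuous integrands. *)
Definition gain_of (R : realType) (g : R -> R -> R)
    (r Rrad phi theta Lx Lz : R) : R :=
  free_space_impedance R / (8 * Rrad) * (Psi phi theta / (4 * pi)) *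
  \int[(lebesgue_measure \x lebesgue_measure)%E]_(p in aperture r Lx Lz)
    g p.1 p.2.

Definition channel_gain (R : realType)
    (r lambda Rrad phi theta Lx Lz : R) : R :=
  gain_of
    (fun x z =>
       f_ phi theta 3 x z
       - 1 / (wavenumber lambda ^+ 2 * r ^+ 2) * f_ phi theta 5 x z
       + 1 / (wavenumber lambda ^+ 4 * r ^+ 4) * f_ phi theta 7 x z)
    r Rrad phi theta Lx Lz.

Definition channel_gain_no_reactive (R : realType)
    (r Rrad phi theta Lx Lz : R) : R :=
  gain_of (fun x z => f_ phi theta 3 x z) r Rrad phi theta Lx Lz.

(* Main.v *)
Require Import Defs.
From HB Require Import structures.
From mathcomp Require Import all_boot all_order all_algebra.
From mathcomp Require Import all_classical all_reals all_analysis.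
From mathcomp Require Import measurable_realfun ring lra.

Set Implicit Arguments.
Unset Strict Implicit.
Unset Printing Implicit Defensive.

Import Order.TTheory GRing.Theory Num.Theory.
Import numFieldNormedType.Exports.

Local Open Scope classical_set_scope.
Local Open Scope ring_scope.

(* The densities are negative powers u^(-p) of
   u = (x - Phi)^2 + Psi^2 + (z - Theta)^2.
   For b > 0, the identity
     (x (x^2 + b)^(-p))' = (1 - 2p) (x^2 + b)^(-p) + 2pb (x^2 + b)^(-p-1)
   yields a primitive for exponent p + 1 from one for exponent p.  Starting from
   p = 3/2 and p = 1 (arctangent), it gives constants C_p with
   int_R ((x - c)^2 + b)^(-p) dx = C_p b^(1/2 - p).
   By Tonelli, the integral of u^(-p) over the plane is
   C_p C_(p-1/2) (Psi^2)^(1-p).  Since u^(-p) >= 0, the integrals over the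
   growing rectangles converge to the integral over the plane. *)

(** * Primitives of negative powers of [x^2 + b] and their limits at infinity *)

Section half_line.
Context {R : realType}.
Implicit Types p b I x : R.

(** The primitive is carried along with its limit because the reduction in the exponent acts on
    primitives; [I] is the integral over the half-line from 0. *)
Definition half_line_primitive p b I := exists F : R -> R,
  [/\ F 0 = 0, forall x, is_derive x 1 F ((x ^+ 2 + b) `^ (- p)) &
      F x @[x --> +oo] --> I].

Lemma sqrD_gt0 b x : 0 < b -> 0 < x ^+ 2 + b.
Proof. by move=> b0; rewrite ltr_wpDl// sqr_ge0. Qed.

Lemma is_derive_mull (c : R) (f : R -> R) x df :
  is_derive x 1 f df -> is_derive x 1 (fun y => c * f y) (c * df).
Proof. exact: is_deriveZ. Qed.

Lemma is_derive_powR_sqrD p b x : 0 < b ->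
  is_derive x 1 (fun y => (y ^+ 2 + b) `^ p)
    (p * (x ^+ 2 + b) `^ (p - 1) * (2 * x)).
Proof.
move=> b0; apply: (@is_derive1_comp _ (@powR R ^~ p) (fun y => y ^+ 2 + b)).
  by apply: is_derive1_powR; exact: sqrD_gt0.
apply: (is_derive_eq (is_deriveD (is_deriveX 2 (is_derive_id x (1 : R)))
  (is_derive_cst b x (1 : R)))).
by rewrite addr0 /GRing.scale/= mulr1 expr1 mulrC.
Qed.

(** Product rule, with the factor [x^2] rewritten as [(x^2 + b) - b]. *)
Lemma is_derive_id_powR_sqrD p b x : 0 < b ->
  is_derive x 1 (fun y => y * (y ^+ 2 + b) `^ (- p))
    ((1 - 2 * p) * (x ^+ 2 + b) `^ (- p)
     + 2 * p * b * (x ^+ 2 + b) `^ (- (p + 1))).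
Proof.
move=> b0; have u0 := sqrD_gt0 x b0.
apply: (is_derive_eq (is_deriveM (is_derive_id _ _)
  (is_derive_powR_sqrD (- p) x b0))).
rewrite /GRing.scale/= (_ : - (p + 1) = - p - 1); last by ring.
have -> : (x ^+ 2 + b) `^ (- p) = (x ^+ 2 + b) `^ (- p - 1) * (x ^+ 2 + b).
  rewrite [in RHS]powRB; last by rewrite (gt_eqF u0) implybT.
  by rewrite powRr1 ?ltW// divfK// gt_eqF.
ring.
Qed.

Lemma cvg_sqrDV b : 0 < b -> (x ^+ 2 + b)^-1 @[x --> +oo] --> 0.
Proof.
move=> b0; apply/gtr0_cvgV0; first by near=> x; exact: sqrD_gt0.
apply/cvgryPge => A; near=> x.
rewrite (@le_trans _ _ (x ^+ 2))// ?lerDl ?(ltW b0)//.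
by near: x; apply: cvgry_ge; exact: cvgr_expr2.
Unshelve. all: by end_near. Qed.

Lemma half_line_primitive1 b : 0 < b ->
  half_line_primitive 1 b (pi / (2 * Num.sqrt b)).
Proof.
move=> b0; have s0 : 0 < Num.sqrt b by rewrite sqrtr_gt0.
exists (fun x => (Num.sqrt b)^-1 * atan ((Num.sqrt b)^-1 * x)); split.
- by rewrite mulr0 atan0 mulr0.
- move=> x; have D : is_derive x 1 (atan \o (fun y => (Num.sqrt b)^-1 * y))
    ((1 + ((Num.sqrt b)^-1 * x) ^+ 2)^-1 * ((Num.sqrt b)^-1 * 1)).
    exact: is_derive1_comp (is_derive1_atan _)
      (is_derive_mull (Num.sqrt b)^-1 (is_derive_id x 1)).
  apply: (is_derive_eq (is_derive_mull (Num.sqrt b)^-1 D)).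
  have u0 := sqrD_gt0 x b0.
  rewrite powRN powRr1 ?(ltW u0)// /GRing.scale/= mulr1 exprMn exprVn.
  rewrite sqr_sqrtr ?(ltW b0)// mulrCA -expr2 exprVn sqr_sqrtr ?(ltW b0)//.
  by field; rewrite !gt_eqF// addrC.
- have -> : pi / (2 * Num.sqrt b) = (Num.sqrt b)^-1 * (pi / 2).
    by field; rewrite gt_eqF.
  apply: cvgMl_tmp; apply: (@cvg_comp _ _ _ (fun x => (Num.sqrt b)^-1 * x) atan _
    (pinfty_nbhs R)); last exact: cvgy_atan.
  by apply: gt0_cvgMry; rewrite ?invr_gt0//; exact: cvg_id.
Qed.

(** The derivative identity is solved for the power [-(p + 1)]. Its boundary term [x (x^2 + b)^(-p)]
    vanishes both at 0 and at infinity, so only the multiple of [F] contributes to the limit. *)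
Lemma half_line_primitive_step p b I : 0 < b -> 1 <= p ->
  half_line_primitive p b I ->
  half_line_primitive (p + 1) b ((2 * p - 1) / (2 * p * b) * I).
Proof.
move=> b0 p1 [F [F0 dF FI]].
exists (fun x => (2 * p * b)^-1 *
  (x * (x ^+ 2 + b) `^ (- p) + (2 * p - 1) * F x)); split.
- by rewrite F0 mul0r mulr0 addr0 mulr0.
- move=> x; apply: (is_derive_eq (is_derive_mull (2 * p * b)^-1 (is_deriveD
    (is_derive_id_powR_sqrD p x b0) (is_derive_mull (2 * p - 1) (dF x))))).
  rewrite /GRing.scale/=; field.
  by rewrite !gt_eqF//; lra.
- have -> : (2 * p - 1) / (2 * p * b) * I =
      (2 * p * b)^-1 * (0 + (2 * p - 1) * I) by rewrite add0r; ring.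
  apply: cvgMl_tmp; apply: cvgD; last by apply: cvgMl_tmp; exact: FI.
  (* With [u = x^2 + b], split [u^(-p)] as [u^(-(p-1)) u^(-1)]: the first factor is at most
     [b^(-(p-1))] since [p >= 1] and [u >= b], and [x / u <= 1 / x]. *)
  have bnd : \forall x \near +oo, 
     0 <= x * (x ^+ 2 + b) `^ (- p) <= b `^ (- (p - 1)) * x^-1.
    near=> x; have x0 : 0 < x by near: x; exact: nbhs_pinfty_gt.
    have u0 := sqrD_gt0 x b0.
    rewrite mulr_ge0 ?powR_ge0 ?(ltW x0)//=.
    have -> : - p = - (p - 1) + -1 by ring.
    rewrite powRD ?(gt_eqF u0) ?implybT// powR_inv1 ?(ltW u0)// mulrCA.
    apply: ler_pM; rewrite ?powR_ge0// ?mulr_ge0 ?invr_ge0 ?(ltW x0) ?(ltW u0)//.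
      rewrite !powRN lef_pV2 ?posrE ?powR_gt0//.
      by rewrite ge0_ler_powR ?subr_ge0// ?nnegrE ?(ltW u0) ?(ltW b0)// lerDr sqr_ge0.
    by rewrite ler_pdivrMr// mulrDr expr2 mulKf ?gt_eqF// lerDl mulr_ge0 ?invr_ge0 ?ltW.
  apply: (squeeze_cvgr bnd); first exact: cvg_cst.
  rewrite -(mulr0 (b `^ (- (p - 1)))); apply: cvgMl_tmp.
  by apply/gtr0_cvgV0; [exact: nbhs_pinfty_gt|exact: cvg_id].
Unshelve. all: by end_near. Qed.

(** At [p = 1/2] the coefficient [1 - 2p] of the derivative identity is zero, so
    [x (x^2 + b)^(-1/2)] is itself [b] times a primitive. *)
Lemma half_line_primitive32 b : 0 < b ->
  half_line_primitive (3 / 2) b b^-1.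
Proof.
move=> b0; exists (fun x => b^-1 * (x * (x ^+ 2 + b) `^ (- 2^-1))); split.
- by rewrite mul0r mulr0.
- move=> x; apply: (is_derive_eq (is_derive_mull b^-1
    (is_derive_id_powR_sqrD 2^-1 x b0))).
  rewrite (_ : 1 - 2 * 2^-1 = 0 :> R) ?mul0r ?add0r; last by field.
  rewrite (_ : 2^-1 + 1 = 3 / 2 :> R); last by field.
  by rewrite /GRing.scale/=; field; rewrite gt_eqF.
- rewrite -[X in _ --> X]mulr1; apply: cvgMl_tmp.
  (* For [x > 0] the quotient [x / sqrt (x^2 + b)] is the square root of [x^2 / (x^2 + b)], whose
     limit follows by continuity of the square root. *)
  have E : \forall x \near +oo,
      Num.sqrt (1 - b * (x ^+ 2 + b)^-1) = x * (x ^+ 2 + b) `^ (- 2^-1).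
    near=> x; have x0 : 0 < x by near: x; exact: nbhs_pinfty_gt.
    have u0 := sqrD_gt0 x b0.
    rewrite powRN powR12_sqrt ?(ltW u0)//.
    have -> : 1 - b * (x ^+ 2 + b)^-1 = x ^+ 2 * (x ^+ 2 + b)^-1.
      by field; rewrite gt_eqF.
    by rewrite sqrtrM ?sqr_ge0// sqrtr_sqr gtr0_norm// sqrtrV ?(ltW u0).
  suff : Num.sqrt (1 - b * (x ^+ 2 + b)^-1) @[x --> +oo] --> (1 : R).
    exact: cvg_trans (near_eq_cvg E).
  have C : 1 - b * (x ^+ 2 + b)^-1 @[x --> +oo] --> (1 - b * 0 : R).
    by apply: cvgB; [exact: cvg_cst|apply: cvgMl_tmp; exact: cvg_sqrDV].
  rewrite mulr0 subr0 in C.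
  by have := cvg_comp _ _ C (@sqrt_continuous R 1); rewrite sqrtr1.
Unshelve. all: by end_near. Qed.

End half_line.

(** * From half-line primitives to integrals over the whole line *)

Section line_integral.
Context {R : realType}.
Implicit Types p b I c x : R.
Let mu := @lebesgue_measure R.

Lemma continuous_powR_sqrD p b : 0 < b ->
  continuous (fun x : R => (x ^+ 2 + b) `^ p).
Proof.
move=> b0 x; apply/differentiable_continuous/derivable1_diffP.
by have [] := is_derive_powR_sqrD p x b0.
Qed.

Lemma ge0_integral_translate (f : R -> R) c :
  continuous f -> (forall x, 0 <= f x) ->
  (\int[mu]_x (f (x - c))%:E = \int[mu]_x (f x)%:E)%E.
Proof.
move=> cf f0; pose F x := x - c.
have dF x : is_derive x 1 F 1.
  apply: (is_derive_eq (is_deriveB (is_derive_id x 1) (is_derive_cst c x 1))).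
  by rewrite subr0.
have F' : derive1 F = cst 1 by apply/funext => x; rewrite derive1E; exact: derive_val.
rewrite (@increasing_ge0_integration_by_substitutionT _ F f)//.
- by apply: eq_integral => x _; rewrite F' /= mulr1.
- by move=> x y xy; rewrite ltrD2r.
- by rewrite F' => x; exact: cvg_cst.
- by rewrite F'; exact: is_cvg_cst.
- by rewrite F'; exact: is_cvg_cst.
- by have := @cvg_addrr_Ny R (- c); under eq_fun do rewrite addrC.
- by have := @cvg_addrr R (- c); under eq_fun do rewrite addrC.
Qed.

(** Translation removes [c], evenness of the integrand gives the factor 2, and the fundamental
    theorem of calculus evaluates the half-line integral as [I - F 0]. *)
Lemma integral_half_line_primitive p b I c : 0 < b ->
  half_line_primitive p b I ->
  (\int[mu]_x (((x - c) ^+ 2 + b) `^ (- p))%:E = (2 * I)%:E)%E.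
Proof.
move=> b0 [F [F0 dF FI]].
have cf := continuous_powR_sqrD (p := - p) b0.
rewrite (@ge0_integral_translate (fun x => (x ^+ 2 + b) `^ (- p)))//; last first.
  by move=> x; exact: powR_ge0.
have cF x : {for x, continuous F}.
  by apply/differentiable_continuous/derivable1_diffP; have [] := dF x.
have f0 x : 0 <= (x ^+ 2 + b) `^ (- p) by exact: powR_ge0.
rewrite ge0_symfun_integralT//; last by move=> x /=; rewrite sqrrN.
rewrite -set_itvcy (@ge0_continuous_FTC2y _ _ F 0 I)//.
- by rewrite F0 sube0 EFinM.
- exact: continuous_subspaceT.
- by apply: cvg_at_right_filter; exact: cF.
- by move=> x _; rewrite derive1E; have [] := dF x.
Qed.

End line_integral.

(** * Plane integrals by Tonelli *)

Section plane_integral.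
Context {R : realType}.
Implicit Types p b c d x z C D : R.
Let mu := @lebesgue_measure R.

(** [C] is the constant C_p, halved here because only a half-line is covered. The quantifier over
    [b] matters: in the double integral the inner [b] depends on the outer variable. *)
Definition half_line_power p C := forall b, 0 < b ->
  half_line_primitive p b (C / 2 * b `^ (2^-1 - p)).

Lemma half_line_power1 : half_line_power 1 pi.
Proof.
move=> b b0; have -> : pi / 2 * b `^ (2^-1 - 1) = pi / (2 * Num.sqrt b).
  rewrite (_ : 2^-1 - 1 = - 2^-1 :> R); last by field.
  by rewrite powRN powR12_sqrt ?(ltW b0)// -mulrA invfM.
exact: half_line_primitive1.
Qed.

Lemma half_line_power32 : half_line_power (3 / 2) 2.
Proof.
move=> b b0; have -> : 2 / 2 * b `^ (2^-1 - 3 / 2) = b^-1.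
  rewrite (_ : 2^-1 - 3 / 2 = - 1 :> R); last by field.
  by rewrite powR_inv1 ?(ltW b0)// divff ?mul1r.
exact: half_line_primitive32.
Qed.

(** The factor [1 / b] of the reduction is absorbed by the power of [b], leaving a purely numerical
    recursion on the constant. *)
Lemma half_line_power_step p C : 1 <= p ->
  half_line_power p C -> half_line_power (p + 1) ((2 * p - 1) / (2 * p) * C).
Proof.
move=> p1 H b b0.
have := half_line_primitive_step b0 p1 (H b b0).
rewrite [X in half_line_primitive _ _ X -> _](_ : _ =
  (2 * p - 1) / (2 * p) * C / 2 * b `^ (2^-1 - (p + 1)))//.
rewrite (_ : 2^-1 - (p + 1) = 2^-1 - p - 1); last by ring.
rewrite [in RHS]powRB; last by rewrite (gt_eqF b0) implybT.
rewrite powRr1 ?(ltW b0)//; field.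
by rewrite (gt_eqF b0) gt_eqF// (lt_le_trans ltr01).
Qed.

Lemma integral_half_line_power p C b c : 0 < b -> half_line_power p C ->
  (\int[mu]_x (((x - c) ^+ 2 + b) `^ (- p))%:E = (C * b `^ (2^-1 - p))%:E)%E.
Proof.
move=> b0 H; rewrite (integral_half_line_primitive c b0 (H b b0)).
by congr EFin; field.
Qed.

Lemma measurable_power_kernel p b c d : measurable_fun [set: R * R]
  (fun q : R * R => ((q.1 - c) ^+ 2 + b + (q.2 - d) ^+ 2) `^ p).
Proof.
apply: (@measurableT_comp _ _ _ _ _ _ (@powR R ^~ p)).
  exact: measurable_powR.
apply: measurable_funD; first apply: measurable_funD => //.
- by apply: measurable_funX; apply: measurable_funB => //; exact: measurable_fst.
- by apply: measurable_funX; apply: measurable_funB => //; exact: measurable_snd.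
Qed.

(** Integrating in [x] first leaves [C ((z - d)^2 + b)^(1/2 - p)], again a one-variable kernel, now
    with exponent [p - 1/2]; integrating it in [z] produces [D]. *)
Lemma integral_power_kernel p C D b c d : 0 < b -> 0 <= C ->
  half_line_power p C -> half_line_power (p - 2^-1) D ->
  (\int[mu \x mu]_q (((q.1 - c) ^+ 2 + b + (q.2 - d) ^+ 2) `^ (- p))%:E =
   (C * D * b `^ (1 - p))%:E)%E.
Proof.
move=> b0 C0 HC HD.
have mk : measurable_fun [set: R * R] (fun q : R * R =>
    (((q.1 - c) ^+ 2 + b + (q.2 - d) ^+ 2) `^ (- p))%:E).
  exact: (proj2 (measurable_EFinP _ _) (@measurable_power_kernel (- p) b c d)).
have mk1 : measurable_fun [set: R]
    (fun z => (((z - d) ^+ 2 + b) `^ (- (p - 2^-1)))%:E).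
  apply/measurable_EFinP; apply: (@measurableT_comp _ _ _ _ _ _ (@powR R ^~ _)).
    exact: measurable_powR.
  by apply: measurable_funD => //; apply: measurable_funX; exact: measurable_funB.
rewrite fubini_tonelli2/=; last 2 first.
- exact: mk.
- by move=> q; rewrite lee_fin powR_ge0.
under eq_integral => z _.
  rewrite /fubini_G/=.
  (* Regrouping makes [(z - d)^2 + b] the positive offset of the inner integral. *)
  under eq_integral do rewrite -addrA (addrC b).
  rewrite (integral_half_line_power c (sqrD_gt0 (z - d) b0) HC) EFinM.
  rewrite (_ : 2^-1 - p = - (p - 2^-1)); last by ring.
  over.
rewrite ge0_integralZl//=; last by move=> z _; rewrite lee_fin powR_ge0.
rewrite (integral_half_line_power d b0 HD) -EFinM mulrA.
by do 3 f_equal; field.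
Qed.

End plane_integral.

(** * Convergence of integrals over growing rectangles *)

Section growing_rectangles.
Context {R : realType}.
Let mu := (@lebesgue_measure R \x @lebesgue_measure R)%E.

Lemma measurable_aperture (r Lx Lz : R) : measurable (aperture r Lx Lz).
Proof. by apply: measurableX; exact: measurable_itv. Qed.

Lemma integrable_ge0_fin (f : R * R -> R) (I : R) :
  measurable_fun [set: R * R] f -> (forall q, 0 <= f q) ->
  (\int[mu]_q (f q)%:E = I%:E)%E -> mu.-integrable setT (EFin \o f).
Proof.
move=> mf f0 fI; apply/integrableP; split; first exact/measurable_EFinP.
under eq_integral do rewrite gee0_abs ?lee_fin//.
by rewrite fI ltry.
Qed.

(** Monotone convergence handles the sequence of squares [S n]. The two-parameter limit follows
    because an aperture with both sides at least [N] has its integral squeezed between that over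
    [S N] and [I]. *)
Lemma cvg_integral_aperture (f : R * R -> R) (r I : R) : 0 < r ->
  measurable_fun [set: R * R] f -> (forall q, 0 <= f q) ->
  (\int[mu]_q (f q)%:E = I%:E)%E ->
  \int[mu]_(q in aperture r L.1 L.2) f q
    @[L --> filter_prod (pinfty_nbhs R) (pinfty_nbhs R)] --> I.
Proof.
move=> r0 mf f0 fI.
have intf := integrable_ge0_fin mf f0 fI.
have mEf A : measurable_fun A (EFin \o f).
  by apply: (@measurable_funS _ _ _ _ setT) => //; exact/measurable_EFinP.
have Ef0 q : (0 <= (EFin \o f) q)%E by rewrite lee_fin.
pose h (a : R) := a / (2 * r).
have hmono a a' : a <= a' -> h a <= h a'.
  by move=> ?; rewrite ler_pM2r// invr_gt0 mulr_gt0.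
have subA (a a' b b' : R) : a <= a' -> b <= b' ->
    aperture r a b `<=` aperture r a' b'.
  move=> /hmono aa' /hmono bb' [x z] [/=]; rewrite !in_itv/= -!ler_norml.
  move=> xa zb; split; rewrite /= in_itv/= -ler_norml.
    exact: le_trans xa aa'.
  exact: le_trans zb bb'.
pose S n := aperture r n%:R n%:R.
have SN : nondecreasing_seq S.
  by move=> m n mn; rewrite subsetEset; apply: subA; rewrite ler_nat.
have ST : \bigcup_n S n = setT.
  apply/seteqP; split=> // -[x z] _.
  (* The aperture has half-side [L / (2 r)], so [N.+1] is large enough for the square to contain
     [(x, z)]. *)
  pose N := Num.trunc (2 * r * Num.max `|x| `|z|).
  have hN : Num.max `|x| `|z| <= h N.+1%:R.
    rewrite ler_pdivlMr ?mulr_gt0// mulrC ltW//.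
    by apply: truncnS_gt.
  exists N.+1 => //; split => /=; rewrite in_itv/= -ler_norml;
    by apply: le_trans hN; rewrite le_max lexx ?orbT.
have : (\int[mu]_(q in S n) (f q)%:E @[n --> \oo] -->
    \int[mu]_(q in \bigcup_n S n) (f q)%:E)%E.
  apply: ge0_nondecreasing_set_cvg_integral => // n.
  - exact: measurable_aperture.
  - exact: mEf.
  - by move=> q _; exact: Ef0.
have -> : (\int[mu]_(q in \bigcup_n S n) (f q)%:E = I%:E)%E.
  by rewrite -fI; congr integral; exact: ST.
move=> /fine_cvg/cvgrPdist_lt cS.
apply/cvgrPdist_lt => e e0.
have [N _ HN] := cS e e0.
exists ([set a | N%:R <= a], [set a | N%:R <= a]) => /=.
  by split; exact: nbhs_pinfty_ge.
move=> [a b] [/= Na Nb].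
have inta c d : mu.-integrable (aperture r c d) (EFin \o f).
  by apply: integrableS intf => //; exact: measurable_aperture.
(* Real integrals are [fine] of extended ones, and [fine] sends infinities to 0, so comparing them
   requires finiteness. *)
have finA c d : (\int[mu]_(q in aperture r c d) (f q)%:E)%E \is a fin_num.
  by apply: integrable_fin_num; [exact: measurable_aperture|exact: inta].
have le1 : \int[mu]_(q in S N) f q <= \int[mu]_(q in aperture r a b) f q.
  apply: fine_le; [exact: finA|exact: finA|].
  apply: ge0_subset_integral; [exact: measurable_aperture|
    exact: measurable_aperture|exact: mEf|by move=> q _; exact: Ef0|].
  exact: subA.
have le2 : \int[mu]_(q in aperture r a b) f q <= I.
  rewrite -[I]/(fine I%:E) -fI; apply: fine_le; [exact: finA|by rewrite fI|].
  by apply: ge0_subset_integral => //;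
    [exact: measurable_aperture|exact: mEf|move=> q _; exact: Ef0].
have := HN N (leqnn N); rewrite /= => HNN.
rewrite ger0_norm ?subr_ge0//; apply: le_lt_trans HNN.
by rewrite (le_trans _ (ler_norm _))// lerB.
Qed.

End growing_rectangles.

Lemma Rintegral_lin3 d (T : measurableType d) (R : realType)
    (mu : {measure set T -> \bar R}) (D : set T) (f g h : T -> R) (a b : R) :
  measurable D -> mu.-integrable D (EFin \o f) ->
  mu.-integrable D (EFin \o g) -> mu.-integrable D (EFin \o h) ->
  \int[mu]_(x in D) (f x - a * g x + b * h x) =
  \int[mu]_(x in D) f x - a * \int[mu]_(x in D) g x
    + b * \int[mu]_(x in D) h x.
Proof.
move=> mD mf mg mh.
have mZ c (k : T -> R) : mu.-integrable D (EFin \o k) ->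
    mu.-integrable D (EFin \o (fun x => c * k x)).
  by move=> mk; exact: (integrableZl mD c mk).
rewrite RintegralD ?RintegralB ?RintegralZl//; try exact: mZ.
exact: (integrableB mD mf (mZ a g mg)).
Qed.

(** * Plane integrals of the densities [f_] *)

Section gain_limit.
Context {R : realType}.
Implicit Types C D : R.
Let mu := (@lebesgue_measure R \x @lebesgue_measure R)%E.

(** For [p = n / 2] the ratio [(2p - 1) / (2p)] is [(n - 1) / n], and [1 < n] is the bound
    [1 <= p]. *)
Lemma half_line_power_step_nat n C : (1 < n)%N ->
  half_line_power (n%:R / 2) C ->
  half_line_power (n.+2%:R / 2) (n.-1%:R / n%:R * C).
Proof.
case: n => [//|n] n1 H.
have n1' : (2 : R) <= n.+1%:R by rewrite ler_nat.
have := half_line_power_step _ H; rewrite ler_pdivlMr// mul1r => /(_ n1').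
have -> : n.+1%:R / 2 + 1 = n.+3%:R / 2 :> R.
  by rewrite -!natr1; field.
have -> // : (2 * (n.+1%:R / 2) - 1) / (2 * (n.+1%:R / 2)) * C =
  n%:R / n.+1%:R * C.
congr (_ * _); rewrite mulrCA divff ?mulr1//.
by rewrite -natr1 addrK.
Qed.

Lemma measurable_f_ (phi theta : R) n :
  measurable_fun [set: R * R] (fun q : R * R => f_ phi theta n q.1 q.2).
Proof. exact: measurable_power_kernel. Qed.

Lemma f__ge0 (phi theta : R) n x z : 0 <= f_ phi theta n x z.
Proof. exact: powR_ge0. Qed.

(** This is the plane integral with [b = Psi^2] and [p = (n + 2) / 2]; positivity of [Psi] turns
    [(Psi^2)^(-n/2)] into [Psi^(-n)]. *)
Lemma integral_f_ (phi theta : R) n C D : 0 < Psi phi theta -> 0 <= C ->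
  half_line_power (n.+2%:R / 2) C -> half_line_power (n.+1%:R / 2) D ->
  (\int[mu]_q (f_ phi theta n.+2 q.1 q.2)%:E =
   (C * D / Psi phi theta ^+ n)%:E)%E.
Proof.
move=> P0 C0 HC HD; rewrite /f_.
rewrite (@integral_power_kernel _ _ C D) ?exprn_gt0//; last first.
  by rewrite (_ : _ - _ = n.+1%:R / 2)// -(natr1 n.+1); field.
do 2 f_equal; rewrite (_ : 1 - _ = - (2^-1 * n%:R)).
  by rewrite powRN powRrM powR12_sqrt ?sqr_ge0// sqrtr_sqr gtr0_norm// powR_mulrn// ltW.
by rewrite -!natr1; field.
Qed.

End gain_limit.

(** * Limits of the channel gain *)

Theorem corollary3 (R : realType) (r lambda Rrad phi theta : R)
    (hr : 0 < r) (hlambda : 0 < lambda) (hRrad : 0 < Rrad)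
    (hphi : 0 <= phi <= pi) (htheta : 0 <= theta <= pi)
    (hPsi : Psi phi theta != 0) :
  (channel_gain r lambda Rrad phi theta L.1 L.2
     @[L --> filter_prod (pinfty_nbhs R) (pinfty_nbhs R)] -->
   free_space_impedance R / (8 * Rrad) *
     (1 / 2
      - 1 / (24 * pi ^+ 2) * (lambda ^+ 2 / (r ^+ 2 * Psi phi theta ^+ 2))
      + 1 / (160 * pi ^+ 4) * (lambda ^+ 4 / (r ^+ 4 * Psi phi theta ^+ 4))))
  /\
  (channel_gain_no_reactive r Rrad phi theta L.1 L.2
     @[L --> filter_prod (pinfty_nbhs R) (pinfty_nbhs R)] -->
   free_space_impedance R / (8 * Rrad) * (1 / 2)).
Proof.
have P0 : 0 < Psi phi theta.
  by rewrite lt_neqAle eq_sym hPsi mulr_ge0// sin_ge0_pi.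
(* [Hn] gives C_(n/2). Even indices start from the arctangent: pi, pi/2, 3pi/8 for n = 2, 4, 6. Odd
   ones start from exponent 3/2: 2, 4/3, 16/15 for n = 3, 5, 7. *)
have H2 : half_line_power (2%:R / 2) (pi : R).
  by rewrite divff//; exact: half_line_power1.
have H3 := @half_line_power32 R.
have H4 := half_line_power_step_nat (isT : 1 < 2)%N H2.
have H5 := half_line_power_step_nat (isT : 1 < 3)%N H3.
have H6 := half_line_power_step_nat (isT : 1 < 4)%N H4.
have H7 := half_line_power_step_nat (isT : 1 < 5)%N H5.
(* Each plane integral pairs the constants of indices n and n - 1; the products for n = 3, 5, 7 are
   2pi, 2pi/3 and 2pi/5. *)
have I3 := integral_f_ P0 (ler0n _ _) H3 H2.
have C5 : 0 <= 3.-1%:R / 3%:R * 2 :> R by rewrite !(mulr_ge0, invr_ge0, ler0n).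
have I5 := integral_f_ P0 C5 H5 H4.
have I7 := integral_f_ P0 (mulr_ge0 (divr_ge0 (ler0n _ _) (ler0n _ _)) C5) H7 H6.
pose mu := (@lebesgue_measure R \x @lebesgue_measure R)%E.
have intA n I (L : R * R) :
    (\int[mu]_q (f_ phi theta n q.1 q.2)%:E = I%:E)%E ->
    mu.-integrable (aperture r L.1 L.2)
      (EFin \o (fun q : R * R => f_ phi theta n q.1 q.2)).
  move=> fI; apply: integrableS (integrable_ge0_fin (measurable_f_ _ _ _) _ fI) => //.
  - exact: measurable_aperture.
  - by move=> q; exact: f__ge0.
have cvgA n I : (\int[mu]_q (f_ phi theta n q.1 q.2)%:E = I%:E)%E ->
    \int[mu]_(q in aperture r L.1 L.2) f_ phi theta n q.1 q.2
      @[L --> filter_prod (pinfty_nbhs R) (pinfty_nbhs R)] --> I.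
  apply: cvg_integral_aperture => //; first exact: measurable_f_.
  by move=> q; exact: f__ge0.
have [/gt_eqF lambda0 /gt_eqF r0] := (hlambda, hr).
have [/gt_eqF Rrad0 /gt_eqF pi0] := (hRrad, pi_gt0 R).
split.
- set a5 := 1 / (wavenumber lambda ^+ 2 * r ^+ 2).
  set a7 := 1 / (wavenumber lambda ^+ 4 * r ^+ 4).
  have E : (fun L : R * R => channel_gain r lambda Rrad phi theta L.1 L.2) =
    fun L => (
      free_space_impedance R / (8 * Rrad) * (Psi phi theta / (4 * pi)) *
      (\int[mu]_(q in aperture r L.1 L.2) f_ phi theta 3 q.1 q.2
       - a5 * \int[mu]_(q in aperture r L.1 L.2) f_ phi theta 5 q.1 q.2
       + a7 * \int[mu]_(q in aperture r L.1 L.2) f_ phi theta 7 q.1 q.2)).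
    apply/funext => L; rewrite /channel_gain /gain_of -/a5 -/a7; congr (_ * _).
    apply: Rintegral_lin3; first exact: measurable_aperture.
    - exact: intA I3.
    - exact: intA I5.
    - exact: intA I7.
  (* The prefactor [Psi / (4 pi)] turns the three integrals into 1/2, 1/(6 Psi^2) and 1/(10 Psi^4);
     the powers of [2 pi / lambda] then give the denominators 24 = 6 * 4 and 160 = 10 * 16. *)
  have -> : free_space_impedance R / (8 * Rrad) *
      (1 / 2
       - 1 / (24 * pi ^+ 2) * (lambda ^+ 2 / (r ^+ 2 * Psi phi theta ^+ 2))
       + 1 / (160 * pi ^+ 4) * (lambda ^+ 4 / (r ^+ 4 * Psi phi theta ^+ 4))) =
    free_space_impedance R / (8 * Rrad) * (Psi phi theta / (4 * pi)) *
    (2 * pi / Psi phi theta ^+ 1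
     - a5 * (3.-1%:R / 3%:R * 2 * (2.-1%:R / 2%:R * pi) / Psi phi theta ^+ 3)
     + a7 * (5.-1%:R / 5%:R * (3.-1%:R / 3%:R * 2) *
         (4.-1%:R / 4%:R * (2.-1%:R / 2%:R * pi)) / Psi phi theta ^+ 5)).
    (* [pi] is made opaque because [field] would unfold it *)
    rewrite /a5 /a7 /wavenumber /=; move: (pi : R) pi0 => p p0; field.
    by rewrite hPsi lambda0 r0 Rrad0 p0.
  rewrite E.
  apply: cvgMl_tmp; apply: cvgD; last by apply: cvgMl_tmp; exact: cvgA I7.
  by apply: cvgB; [exact: cvgA I3|apply: cvgMl_tmp; exact: cvgA I5].
- rewrite /channel_gain_no_reactive /gain_of.
  have -> : free_space_impedance R / (8 * Rrad) * (1 / 2) =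
    free_space_impedance R / (8 * Rrad) * (Psi phi theta / (4 * pi)) *
    (2 * pi / Psi phi theta ^+ 1).
    by rewrite expr1; move: (pi : R) pi0 => p p0; field; rewrite hPsi Rrad0 p0.
  by apply: cvgMl_tmp; exact: cvgA I3.
Qed.
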